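(* Let $(A,\cdot,\circ)$ be an anti-pre-Lie Poisson algebra and let $r\in A\otimes A$ be a skew-symmetric solution of the APLP-YBE in $(A,\cdot,\circ)$. Then $(A,\cdot,\circ,\Delta,\delta)$ is an anti-pre-Lie Poisson bialgebra, where $\Delta=\Delta_r$ and $\delta=\delta_r$ are defined for all $x\in A$ by $$\Delta_r(x)=\big(\mathcal L_\cdot(x)\otimes\mathrm{id}-\mathrm{id}\otimes\mathcal L_\cdot(x)\big)r,\qquad \delta_r(x)=\big(-\mathcal L_\circ(x)\otimes\mathrm{id}+\mathrm{id}\otimes\mathrm{ad}(x)\big)r.$$
   Context: All vector spaces and algebras are finite-dimensional over an algebraically closed field $\mathbb K$ of characteristic zero. Anti-pre-Lie algebra $(A,\circ)$: with $[x,y]=x\circ y-y\circ x$, $x\circ(y\circ z)-y\circ(x\circ z)=[y,x]\circ z$ and $[x,y]\circ z+[y,z]\circ x+[z,x]\circ y=0$. Anti-pre-Lie Poisson algebra $(A,\cdot,\circ)$: $(A,\cdot)$ commutative associative, $(A,\circ)$ anti-pre-Lie, $2(x\circ y)\cdot z-2(y\circ x)\cdot z=y\cdot(x\circ z)-x\cdot(y\circ z)$ and $2x\circ(y\cdot z)=(z\cdot x)\circ y+z\cdot(x\circ y)$. Notation: $\mathcal L_\cdot(x)y=x\cdot y$, $\mathcal L_\circ(x)y=x\circ y=\mathcal R_\circ(y)x$, $\mathrm{ad}(x)y=[x,y]$; $\tau(x\otimes y)=y\otimes x$, $\xi(x\otimes y\otimes z)=y\otimes z\otimes x$. APLP-YBE: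 $r=\sum_ia_i\otimes b_i$ is a solution if $\mathbf A(r)=\mathbf T(r)=0$, where $\mathbf A(r)=\sum_{i,j}\big(a_i\cdot a_j\otimes b_i\otimes b_j-a_j\otimes a_i\cdot b_j\otimes b_i+a_i\otimes a_j\otimes b_i\cdot b_j\big)$, $\mathbf T(r)=\sum_{i,j}\big(a_i\circ a_j\otimes b_i\otimes b_j+a_i\otimes b_i\circ a_j\otimes b_j-a_i\otimes a_j\otimes[b_i,b_j]\big)$. $r$ is skew-symmetric if $\tau(r)=-r$. Anti-pre-Lie coalgebra $(A,\delta)$: $(\mathrm{id}^{\otimes3}-\tau\otimes\mathrm{id})(\mathrm{id}\otimes\delta)\delta=(\tau\otimes\mathrm{id}-\mathrm{id}^{\otimes3})(\delta\otimes\mathrm{id})\delta$ and $(\mathrm{id}^{\otimes3}+\xi+\xi^2)(\tau\otimes\mathrm{id}-\mathrm{id}^{\otimes3})(\delta\otimes\mathrm{id})\delta=0$. Anti-pre-Lie bialgebra $(A,\circ,\delta)$: $(A,\circ)$ anti-pre-Lie algebra, $(A,\delta)$ anti-pre-Lie coalgebra, and for all $x,y$: $(\mathrm{id}^{\otimes2}-\tau)\big(\delta(x\circ y)-(\mathcal L_\circ(x)\otimes\mathrm{id})\delta(y)-(\mathrm{id}\otimes\mathcal L_\circ(x))\delta(y)+(\mathrm{id}\otimes\mathcal R_\circ(y))\delta(x)\big)=0$, $\delta([x,y])=(\mathrm{id}\otimes\mathrm{ad}(x)-\mathcal L_\circ(x)\otimes\mathrm{id})\delta(y)-(\mathrm{id}\otimes\mathrm{ad}(y)-\mathcal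 L_\circ(y)\otimes\mathrm{id})\delta(x)$. Commutative and cocommutative infinitesimal bialgebra $(A,\cdot,\Delta)$: $(A,\cdot)$ commutative associative, $\tau\Delta=\Delta$, $(\mathrm{id}\otimes\Delta)\Delta=(\Delta\otimes\mathrm{id})\Delta$ (i.e. $(A,\Delta)$ is a cocommutative coassociative coalgebra), and $\Delta(x\cdot y)=(\mathcal L_\cdot(x)\otimes\mathrm{id})\Delta(y)+(\mathrm{id}\otimes\mathcal L_\cdot(y))\Delta(x)$. Anti-pre-Lie Poisson coalgebra $(A,\Delta,\delta)$: $(A,\Delta)$ is a cocommutative coassociative coalgebra, $(A,\delta)$ is an anti-pre-Lie coalgebra, and $2(\delta\otimes\mathrm{id})\Delta-2(\tau\otimes\mathrm{id})(\delta\otimes\mathrm{id})\Delta=(\tau\otimes\mathrm{id})(\mathrm{id}\otimes\delta)\Delta-(\mathrm{id}\otimes\delta)\Delta$, $2(\mathrm{id}\otimes\Delta)\delta=(\mathrm{id}\otimes\tau)(\Delta\otimes\mathrm{id})\delta+(\delta\otimes\mathrm{id})\Delta$. Anti-pre-Lie Poisson bialgebra $(A,\cdot,\circ,\Delta,\delta)$: $(A,\cdot,\circ)$ is an anti-pre-Lie Poisson algebra, $(A,\Delta,\delta)$ an anti-pre-Lie Poisson coalgebra, $(A,\cdot,\Delta)$ a commutative and cocommutative infinitesimal bialgebra, $(A,\circ,\delta)$ an anti-pre-Lie bialgebra, and for all $x,y\in A$: (B1) $2(\mathcal L_\circ(x)\otimes\mathrm{id})\Delta(y)-2(\mathrm{id}\otimes\mathcal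 L_\cdot(y))\delta(x)+\delta(x\cdot y)+(\mathcal L_\cdot(y)\otimes\mathrm{id})\delta(x)-(\mathrm{id}\otimes\mathrm{ad}(x))\Delta(y)=0$; (B2) $2\Delta([x,y])+(\mathrm{id}\otimes\mathrm{ad}(y))\Delta(x)-(\mathcal L_\cdot(x)\otimes\mathrm{id})\delta(y)-(\mathrm{id}\otimes\mathrm{ad}(x))\Delta(y)+(\mathcal L_\cdot(y)\otimes\mathrm{id})\delta(x)=0$; (B3) $2(\mathrm{id}\otimes\mathcal L_\cdot(y))\delta(x)-2(\mathcal L_\circ(x)\otimes\mathrm{id})\Delta(y)+\Delta(x\circ y)+(\mathcal R_\circ(y)\otimes\mathrm{id})\Delta(x)+\tau(\mathcal L_\cdot(x)\otimes\mathrm{id})\delta(y)-(\mathrm{id}\otimes\mathcal L_\cdot(x))\delta(y)=0$; (B4) $(\tau-\mathrm{id}^{\otimes2})\big(2\delta(x\cdot y)-(\mathcal L_\cdot(x)\otimes\mathrm{id})\delta(y)-(\mathrm{id}\otimes\mathcal L_\cdot(x))\delta(y)-(\mathrm{id}\otimes\mathcal R_\circ(y))\Delta(x)\big)=0$. *)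

(* Defs.v *)
From HB Require Import structures.
From mathcomp Require Import all_boot all_order all_algebra.

Set Implicit Arguments.
Unset Strict Implicit.
Unset Printing Implicit Defensive.

Import GRing.Theory.
Local Open Scope ring_scope.

(* MathComp has no tensor product of vector spaces. [tensor V W] is the space
   of coordinate arrays over the bases [vbasis {:V}] and [vbasis {:W}]; an
   array t stands for \sum_(i, j) t i j *: (e_i \ox e_j). The lemmas
   [bilinear_tens], [tlift_tens], [tlift_linear] and [tlift_uniq] are the
   universal property, so nothing below depends on the bases. *)
Definition tensor (K : fieldType) (V W : vectType K) : Type :=
  'M[K]_(\dim {:V}, \dim {:W}).

Definition tens (K : fieldType) (V W : vectType K) (x : V) (y : W) :
    tensor V W :=
  \matrix_(i, j) (coord (vbasis {:V}) i x * coord (vbasis {:W}) j y).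

Notation "x \ox y" := (tens x y)
  (at level 40, left associativity, format "x  \ox  y") : ring_scope.

(* The linear map V (x) W -> U with x \ox y |-> f x y, for bilinear f. *)
Definition tlift (K : fieldType) (V W U : vectType K) (f : V -> W -> U)
    (t : tensor V W) : U :=
  \sum_i \sum_j t i j *: f (vbasis {:V})`_i (vbasis {:W})`_j.

Section TensorTheory.
Variables (K : fieldType) (V W U : vectType K).

Lemma bilinear_tens : bilinear_for *:%R *:%R (@tens K V W).
Proof.
by split=> [y|x] a u v; apply/matrixP=> i j; rewrite !mxE linearP /=;
  rewrite ?mulrDl ?mulrDr ?mulrA // [_ * a]mulrC -mulrA.
Qed.

Lemma tens_basis (i : 'I_(\dim {:V})) (j : 'I_(\dim {:W})) :
  (vbasis {:V})`_i \ox (vbasis {:W})`_j = delta_mx i j :> tensor V W.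
Proof.
have fV := basis_free (vbasisP {:V}); have fW := basis_free (vbasisP {:W}).
apply/matrixP=> k l; rewrite !mxE !coord_free // -natrM mulnb.
by rewrite [k == i]eq_sym [l == j]eq_sym.
Qed.

Lemma tensor_sum (t : tensor V W) :
  t = \sum_i \sum_j t i j *: ((vbasis {:V})`_i \ox (vbasis {:W})`_j).
Proof.
rewrite {1}[t]matrix_sum_delta; apply: eq_bigr => i _; apply: eq_bigr => j _.
by rewrite tens_basis.
Qed.

Lemma tlift_linear (f : V -> W -> U) : linear (tlift f).
Proof.
move=> a s t; rewrite /tlift scaler_sumr -big_split; apply: eq_bigr => i _ /=.
rewrite scaler_sumr -big_split; apply: eq_bigr => j _ /=.
by rewrite !mxE scalerDl scalerA.
Qed.

Lemma tlift_tens (f : V -> W -> U) x y :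
  bilinear_for *:%R *:%R f -> tlift f (x \ox y) = f x y.
Proof.
case=> fl fr.
pose Fr u := GRing.isLinear.Build K W U *:%R (f u) (fr u).
pose fR u : {linear W -> U} := HB.pack (f u) (Fr u).
pose Fl v := GRing.isLinear.Build K V U *:%R (f^~ v) (fl v).
pose fL v : {linear V -> U} := HB.pack (f^~ v) (Fl v).
rewrite {2}(coord_vbasis (memvf x)).
rewrite -[RHS]/(fL y _) linear_sum; apply: eq_bigr => i _.
rewrite linearZ /= {2}(coord_vbasis (memvf y)).
rewrite -[f _ _]/(fR (vbasis {:V})`_i _) linear_sum scaler_sumr.
by apply: eq_bigr => j _; rewrite linearZ /= mxE scalerA.
Qed.

Lemma tlift_uniq (f : V -> W -> U) (h : tensor V W -> U) :
  linear h -> (forall x y, h (x \ox y) = f x y) -> h =1 tlift f.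
Proof.
move=> hl hf t.
pose H : {linear tensor V W -> U} :=
  HB.pack h (GRing.isLinear.Build K (tensor V W) U *:%R h hl).
rewrite {1}[t]tensor_sum -[h _]/(H _) linear_sum; apply: eq_bigr => i _.
rewrite linear_sum; apply: eq_bigr => j _.
by rewrite linearZ /= hf.
Qed.

Lemma tlift_sum (f : V -> W -> U) n (a : 'I_n -> V) (b : 'I_n -> W) :
    bilinear_for *:%R *:%R f ->
  tlift f (\sum_i a i \ox b i) = \sum_i f (a i) (b i).
Proof.
move=> bf.
pose H : {linear tensor V W -> U} :=
  HB.pack (tlift f) (GRing.isLinear.Build K (tensor V W) U *:%R _ (tlift_linear f)).
rewrite -[LHS]/(H _) linear_sum; apply: eq_bigr => i _.
exact: tlift_tens.
Qed.

Lemma tlift_param (T : vectType K) (f : T -> V -> W -> U) (t : tensor V W) :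
  (forall v w, linear (fun x => f x v w)) -> linear (fun x => tlift (f x) t).
Proof.
move=> fl a x y; rewrite /tlift scaler_sumr -big_split; apply: eq_bigr => i _.
rewrite scaler_sumr -big_split; apply: eq_bigr => j _ /=.
by rewrite fl scalerDr !scalerA [a * _]mulrC.
Qed.

End TensorTheory.

Section TensorMaps.
Variable K : fieldType.

(* f (x) g, for linear f and g *)
Definition tmap (V V' W W' : vectType K) (f : V -> V') (g : W -> W') :
    tensor V W -> tensor V' W' :=
  tlift (fun x y => f x \ox g y).

Definition tswap (V W : vectType K) : tensor V W -> tensor W V :=
  tlift (fun x y => y \ox x).

Definition tassoc (U V W : vectType K) :
    tensor (tensor U V) W -> tensor U (tensor V W) :=
  tlift (fun t z => tlift (fun x y => x \ox (y \ox z)) t).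

(* The third tensor power is taken to be A (x) (A (x) A). *)
Definition tensor3 (A : vectType K) := tensor A (tensor A A).

Section Power3.
Variable A : vectType K.

Definition tau : tensor A A -> tensor A A := @tswap A A.

Definition tau_id : tensor3 A -> tensor3 A :=
  tlift (fun x => tlift (fun y z => y \ox (x \ox z))).

Definition id_tau : tensor3 A -> tensor3 A := tmap idfun tau.

Definition xi : tensor3 A -> tensor3 A :=
  tlift (fun x => tlift (fun y z => y \ox (z \ox x))).

(* [id_map delta] is id (x) delta; [map_id delta] is delta (x) id, reassociated
   so that it also lands in A (x) (A (x) A). *)
Definition id_map (delta : A -> tensor A A) : tensor A A -> tensor3 A :=
  tmap idfun delta.

Definition map_id (delta : A -> tensor A A) : tensor A A -> tensor3 A :=
  @tassoc A A A \o tmap delta idfun.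

End Power3.
End TensorMaps.

Section Structures.
Variables (K : fieldType) (A : vectType K).
Implicit Types (mul circ : A -> A -> A) (Delta delta : A -> tensor A A).

Definition bracket circ (x y : A) : A := circ x y - circ y x.

Record comm_assoc_algebra mul : Prop := {
  mul_bilinear : bilinear_for *:%R *:%R mul;
  mul_comm : commutative mul;
  mul_assoc : associative mul }.

Record anti_pre_lie_algebra circ : Prop := {
  circ_bilinear : bilinear_for *:%R *:%R circ;
  circ_anti : forall x y z,
    circ x (circ y z) - circ y (circ x z) = circ (bracket circ y x) z;
  circ_cyclic : forall x y z,
    circ (bracket circ x y) z + circ (bracket circ y z) x
      + circ (bracket circ z x) y = 0 }.

Record aplp_algebra mul circ : Prop := {
  aplp_mul : comm_assoc_algebra mul;
  aplp_circ : anti_pre_lie_algebra circ;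
  aplp_compat1 : forall x y z,
    2 *: mul (circ x y) z - 2 *: mul (circ y x) z
      = mul y (circ x z) - mul x (circ y z);
  aplp_compat2 : forall x y z,
    2 *: circ x (mul y z) = circ (mul z x) y + mul z (circ x y) }.

Record cocomm_coassoc_coalgebra Delta : Prop := {
  Delta_linear : linear Delta;
  Delta_cocomm : forall x, tau (Delta x) = Delta x;
  Delta_coassoc : forall x,
    id_map Delta (Delta x) = map_id Delta (Delta x) }.

Record anti_pre_lie_coalgebra delta : Prop := {
  delta_linear : linear delta;
  delta_anti : forall x,
    id_map delta (delta x) - tau_id (id_map delta (delta x))
      = tau_id (map_id delta (delta x)) - map_id delta (delta x);
  delta_cyclic : forall x,
    let t := tau_id (map_id delta (delta x)) - map_id delta (delta x) in
    t + xi t + xi (xi t) = 0 }.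

Record aplp_coalgebra Delta delta : Prop := {
  aplp_Delta : cocomm_coassoc_coalgebra Delta;
  aplp_delta : anti_pre_lie_coalgebra delta;
  aplp_cocompat1 : forall x,
    2 *: map_id delta (Delta x) - 2 *: tau_id (map_id delta (Delta x))
      = tau_id (id_map delta (Delta x)) - id_map delta (Delta x);
  aplp_cocompat2 : forall x,
    2 *: id_map Delta (delta x)
      = id_tau (map_id Delta (delta x)) + map_id delta (Delta x) }.

Record inf_bialgebra mul Delta : Prop := {
  inf_mul : comm_assoc_algebra mul;
  inf_Delta : cocomm_coassoc_coalgebra Delta;
  inf_compat : forall x y,
    Delta (mul x y)
      = tmap (mul x) idfun (Delta y) + tmap idfun (mul y) (Delta x) }.

Record anti_pre_lie_bialgebra circ delta : Prop := {
  apl_circ : anti_pre_lie_algebra circ;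
  apl_delta : anti_pre_lie_coalgebra delta;
  apl_compat1 : forall x y,
    let t := delta (circ x y) - tmap (circ x) idfun (delta y)
             - tmap idfun (circ x) (delta y)
             + tmap idfun (circ^~ y) (delta x) in
    t - tau t = 0;
  apl_compat2 : forall x y,
    delta (bracket circ x y)
      = (tmap idfun (bracket circ x) (delta y)
           - tmap (circ x) idfun (delta y))
        - (tmap idfun (bracket circ y) (delta x)
             - tmap (circ y) idfun (delta x)) }.

Record aplp_bialgebra mul circ Delta delta : Prop := {
  bialg_algebra : aplp_algebra mul circ;
  bialg_coalgebra : aplp_coalgebra Delta delta;
  bialg_inf : inf_bialgebra mul Delta;
  bialg_apl : anti_pre_lie_bialgebra circ delta;
  bialg_B1 : forall x y,
    2 *: tmap (circ x) idfun (Delta y) - 2 *: tmap idfun (mul y) (delta x)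
      + delta (mul x y) + tmap (mul y) idfun (delta x)
      - tmap idfun (bracket circ x) (Delta y) = 0;
  bialg_B2 : forall x y,
    2 *: Delta (bracket circ x y) + tmap idfun (bracket circ y) (Delta x)
      - tmap (mul x) idfun (delta y) - tmap idfun (bracket circ x) (Delta y)
      + tmap (mul y) idfun (delta x) = 0;
  bialg_B3 : forall x y,
    2 *: tmap idfun (mul y) (delta x) - 2 *: tmap (circ x) idfun (Delta y)
      + Delta (circ x y) + tmap (circ^~ y) idfun (Delta x)
      + tau (tmap (mul x) idfun (delta y))
      - tmap idfun (mul x) (delta y) = 0;
  bialg_B4 : forall x y,
    let t := 2 *: delta (mul x y) - tmap (mul x) idfun (delta y)
             - tmap idfun (mul x) (delta y)
             - tmap idfun (circ^~ y) (Delta x) in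
    tau t - t = 0 }.

Definition skew_symmetric (r : tensor A A) : Prop := tau r = - r.

(* In [ybe_A] and [ybe_T], a \ox b and c \ox d are the generic terms
   a_i (x) b_i and a_j (x) b_j of the two copies of r; see [ybe_A_sum] and
   [ybe_T_sum]. *)
Definition ybe_A_term mul (a b c d : A) : tensor3 A :=
  mul a c \ox (b \ox d) - c \ox (mul a d \ox b) + a \ox (c \ox mul b d).

Definition ybe_A mul (r : tensor A A) : tensor3 A :=
  tlift (fun a b => tlift (ybe_A_term mul a b) r) r.

Definition ybe_T_term circ (a b c d : A) : tensor3 A :=
  circ a c \ox (b \ox d) + a \ox (circ b c \ox d)
    - a \ox (c \ox bracket circ b d).

Definition ybe_T circ (r : tensor A A) : tensor3 A :=
  tlift (fun a b => tlift (ybe_T_term circ a b) r) r.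

Definition aplp_ybe_solution mul circ (r : tensor A A) : Prop :=
  ybe_A mul r = 0 /\ ybe_T circ r = 0.

Lemma tens_linearl (V W : vectType K) (y : W) : linear (fun x : V => x \ox y).
Proof. exact: (bilinear_tens V W).1. Qed.

Lemma tens_linearr (V W : vectType K) (x : V) : linear (fun y : W => x \ox y).
Proof. exact: (bilinear_tens V W).2. Qed.

Let linD (V W : vectType K) (f g : V -> W) :
  linear f -> linear g -> linear (fun x => f x + g x).
Proof. by move=> lf lg a u v; rewrite lf lg scalerDr addrACA. Qed.

Let linN (V W : vectType K) (f : V -> W) : linear f -> linear (fun x => - f x).
Proof. by move=> lf a u v; rewrite lf opprD scalerN. Qed.

Let linC (V W X : vectType K) (g : W -> X) (f : V -> W) :
  linear g -> linear f -> linear (fun x => g (f x)).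
Proof. by move=> lg lf a u v; rewrite lf lg. Qed.

Let linI (V : vectType K) : linear (fun x : V => x).
Proof. by []. Qed.

Let ybe_sum (f : A -> A -> A -> A -> tensor3 A) n (a b : 'I_n -> A) :
    (forall y z w, linear (fun x => f x y z w)) ->
    (forall x z w, linear (fun y => f x y z w)) ->
    (forall x y w, linear (fun z => f x y z w)) ->
    (forall x y z, linear (fun w => f x y z w)) ->
  let r := \sum_i a i \ox b i in
  tlift (fun x y => tlift (f x y) r) r
    = \sum_i \sum_j f (a i) (b i) (a j) (b j).
Proof.
move=> f1 f2 f3 f4 r; rewrite {2}/r tlift_sum.
  by apply: eq_bigr => i _; rewrite tlift_sum //; split=> x.
split=> x; apply: tlift_param => v w //.
Qed.

Lemma ybe_A_sum mul n (a b : 'I_n -> A) : bilinear_for *:%R *:%R mul ->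
  ybe_A mul (\sum_i a i \ox b i)
    = \sum_i \sum_j
        (mul (a i) (a j) \ox (b i \ox b j) - a j \ox (mul (a i) (b j) \ox b i)
         + a i \ox (a j \ox mul (b i) (b j))).
Proof.
case=> ml mr; apply: ybe_sum => x y z; rewrite /ybe_A_term.
all: repeat first
  [ apply: linI | apply: linD | apply: linN | apply: ml | apply: mr
  | apply: (linC (tens_linearl _)) | apply: (linC (tens_linearr _))
  | apply: (linC (ml _)) | apply: (linC (mr _)) ].
Qed.

Lemma ybe_T_sum circ n (a b : 'I_n -> A) : bilinear_for *:%R *:%R circ ->
  ybe_T circ (\sum_i a i \ox b i)
    = \sum_i \sum_j
        (circ (a i) (a j) \ox (b i \ox b j) + a i \ox (circ (b i) (a j) \ox b j)
         - a i \ox (a j \ox bracket circ (b i) (b j))).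
Proof.
case=> ml mr; apply: ybe_sum => x y z; rewrite /ybe_T_term /bracket.
all: repeat first
  [ apply: linI | apply: linD | apply: linN | apply: ml | apply: mr
  | apply: (linC (tens_linearl _)) | apply: (linC (tens_linearr _))
  | apply: (linC (ml _)) | apply: (linC (mr _)) ].
Qed.

Definition Delta_r mul (r : tensor A A) (x : A) : tensor A A :=
  tmap (mul x) idfun r - tmap idfun (mul x) r.

Definition delta_r circ (r : tensor A A) (x : A) : tensor A A :=
  - tmap (circ x) idfun r + tmap idfun (bracket circ x) r.

End Structures.

(* Main.v *)
(* By skew-symmetry each double sum over r = \sum a (x) b whose terms put both
   copies of r in a common leg can be rewritten so that the common leg is p(a, c)
   and the other two legs are b and d, in this order ([leg1], [leg2], [leg3]).
   In this form both sides of a coalgebra axiom are combinations of the two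
   Yang-Baxter equations with one leg acted on by x, and of identities of degree
   three of the algebra in a single leg. The bialgebra compatibilities are linear
   in r and follow from skew-symmetry and the degree three identities alone. In
   all cases mixed words z . (x o y) are eliminated by the second compatibility,
   after which the first one says that x o (y . z) + (y . z) o x is symmetric in
   x, y, z. The integer coefficients of these combinations solve linear systems
   over the monomials of degree three. *)

Require Import Defs.
From HB Require Import structures.
From mathcomp Require Import all_boot all_order all_algebra.
From mathcomp Require Import ring.
Set Implicit Arguments.
Unset Strict Implicit.
Unset Printing Implicit Defensive.
Import GRing.Theory.
Local Open Scope ring_scope.

(** * Calculus of linear maps on tensors *)

Section TensorCalculus.
Variable K : fieldType.
Implicit Types U V W : vectType K.

Lemma lin_add U V (f : U -> V) : linear f -> {morph f : x y / x + y}.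
Proof. by move=> fl x y; have := fl 1 x y; rewrite !scale1r. Qed.

Lemma lin_zero U V (f : U -> V) : linear f -> f 0 = 0.
Proof. by move=> fl; apply: (addrI (f 0)); rewrite -lin_add // !addr0. Qed.

Lemma lin_opp U V (f : U -> V) : linear f -> {morph f : x / - x}.
Proof.
by move=> fl x; apply: (addrI (f x)); rewrite -lin_add // !subrr lin_zero.
Qed.

Lemma lin_scale U V (f : U -> V) :
  linear f -> forall k, {morph f : x / k *: x}.
Proof. by move=> fl k x; have := fl k x 0; rewrite (lin_zero fl) !addr0. Qed.

Lemma coord_eq U (u v : U) :
  (forall i, coord (vbasis {:U}) i u = coord (vbasis {:U}) i v) -> u = v.
Proof.
move=> uv; rewrite (coord_vbasis (memvf u)) (coord_vbasis (memvf v)).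
by apply: eq_bigr => i _; rewrite uv.
Qed.

Lemma tlift_comp U U' V W (h : U -> U') (f : V -> W -> U) (t : tensor V W) :
  linear h -> h (tlift f t) = tlift (fun x y => h (f x y)) t.
Proof.
move=> hl.
pose H : {linear U -> U'} := HB.pack h (GRing.isLinear.Build K U U' *:%R h hl).
rewrite -[h _]/(H _) linear_sum; apply: eq_bigr => i _.
by rewrite linear_sum; apply: eq_bigr => j _; rewrite linearZ.
Qed.

Lemma eq_tlift U V W (f g : V -> W -> U) (t : tensor V W) :
  f =2 g -> tlift f t = tlift g t.
Proof. by move=> fg; do 2!apply: eq_bigr => ? _; rewrite fg. Qed.

Lemma tliftD U V W (f g : V -> W -> U) (t : tensor V W) :
  tlift f t + tlift g t = tlift (fun x y => f x y + g x y) t.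
Proof.
by rewrite -big_split; apply: eq_bigr => i _; rewrite -big_split;
  apply: eq_bigr => j _; rewrite scalerDr.
Qed.

Lemma tliftZ U V W k (f : V -> W -> U) (t : tensor V W) :
  k *: tlift f t = tlift (fun x y => k *: f x y) t.
Proof.
by rewrite (tlift_comp (h := *:%R k)) // => a u v;
  rewrite scalerDr !scalerA mulrC.
Qed.

Lemma tliftN U V W (f : V -> W -> U) (t : tensor V W) :
  - tlift f t = tlift (fun x y => - f x y) t.
Proof.
by rewrite (tlift_comp (h := -%R)) // => a u v; rewrite opprD scalerN.
Qed.

Lemma tlift0 U V W (f : V -> W -> U) (t : tensor V W) :
  (forall x y, f x y = 0) -> tlift f t = 0.
Proof. by move=> f0; do 2!apply: big1 => ? _; rewrite f0 scaler0. Qed.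

Lemma tlift_exchange U V W V' W' (f : V -> W -> V' -> W' -> U)
    (t : tensor V W) (t' : tensor V' W') :
  tlift (fun a b => tlift (f a b) t') t
    = tlift (fun c d => tlift (fun a b => f a b c d) t) t'.
Proof.
rewrite /tlift !pair_big.
under eq_bigr do rewrite pair_big scaler_sumr.
under [RHS]eq_bigr do rewrite pair_big scaler_sumr.
rewrite exchange_big; apply: eq_bigr => p _; apply: eq_bigr => q _.
by rewrite !scalerA mulrC.
Qed.

Lemma tmap_tens V V' W W' (f : V -> V') (g : W -> W') x y :
  linear f -> linear g -> tmap f g (x \ox y) = f x \ox g y.
Proof.
move=> fl gl; apply: tlift_tens; split=> [v|u] a s t.
  by rewrite fl tens_linearl.
by rewrite gl tens_linearr.
Qed.

Lemma tmap_linear V V' W W' (f : V -> V') (g : W -> W') : linear (tmap f g).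
Proof. exact: tlift_linear. Qed.

Lemma tau_tens V (x y : V) : tau (x \ox y) = y \ox x.
Proof.
apply: tlift_tens.
by split=> [v|u]; [apply: tens_linearr | apply: tens_linearl].
Qed.

(** Both factors carry the same basis, so the swap transposes the coordinate array; skew-symmetry
    thereby becomes a condition on entries. *)
Lemma tau_trmx V (t : tensor V V) : tau t = t^T.
Proof.
rewrite [RHS]matrix_sum_delta exchange_big; apply: eq_bigr => i _.
by apply: eq_bigr => j _; rewrite tens_basis !mxE.
Qed.

Lemma tensDl V W (x x' : V) (y : W) : (x + x') \ox y = x \ox y + x' \ox y.
Proof. by have := tens_linearl y 1 x x'; rewrite !scale1r. Qed.

Lemma tensDr V W (x : V) (y y' : W) : x \ox (y + y') = x \ox y + x \ox y'.
Proof. by have := tens_linearr x 1 y y'; rewrite !scale1r. Qed.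

Lemma tensZl V W k (x : V) (y : W) : (k *: x) \ox y = k *: (x \ox y).
Proof. by apply/matrixP=> i j; rewrite !mxE linearZ mulrA. Qed.

Lemma tensZr V W k (x : V) (y : W) : x \ox (k *: y) = k *: (x \ox y).
Proof. by apply/matrixP=> i j; rewrite !mxE linearZ mulrCA. Qed.

Lemma tensNl V W (x : V) (y : W) : (- x) \ox y = - (x \ox y).
Proof. by rewrite -scaleN1r tensZl scaleN1r. Qed.

Lemma tensNr V W (x : V) (y : W) : x \ox (- y) = - (x \ox y).
Proof. by rewrite -scaleN1r tensZr scaleN1r. Qed.

Lemma tens0l V W (y : W) : (0 : V) \ox y = 0.
Proof. exact: lin_zero (tens_linearl y). Qed.

Lemma tens0r V W (x : V) : x \ox (0 : W) = 0.
Proof. exact: lin_zero (tens_linearr x). Qed.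

Lemma tassoc_tens U V W (t : tensor U V) (z : W) :
  tassoc (t \ox z) = tlift (fun x y => x \ox (y \ox z)) t.
Proof.
apply: tlift_tens; split=> [w|s]; first exact: tlift_linear.
by apply: tlift_param => x y k u v; rewrite !(tens_linearr, tensDr, tensZr).
Qed.

Lemma tau_id_tens V (x y z : V) : tau_id (x \ox (y \ox z)) = y \ox (x \ox z).
Proof.
rewrite /tau_id tlift_tens; last first.
  split=> [w|s]; last exact: tlift_linear.
  by apply: tlift_param => u v k s t; rewrite !(tensDl, tensDr, tensZl, tensZr).
by rewrite tlift_tens //; split=> [w|s] k u v;
  rewrite !(tensDl, tensDr, tensZl, tensZr).
Qed.

Lemma xi_tens V (x y z : V) : xi (x \ox (y \ox z)) = y \ox (z \ox x).
Proof.
rewrite /xi tlift_tens; last first.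
  split=> [w|s]; last exact: tlift_linear.
  by apply: tlift_param => u v k s t; rewrite !(tensDl, tensDr, tensZl, tensZr).
by rewrite tlift_tens //; split=> [w|s] k u v;
  rewrite !(tensDl, tensDr, tensZl, tensZr).
Qed.

Lemma id_tau_tens V (x y z : V) : id_tau (x \ox (y \ox z)) = x \ox (z \ox y).
Proof. by rewrite /id_tau tmap_tens ?tau_tens //; apply: tlift_linear. Qed.

End TensorCalculus.

(** * Double sums over two copies of a skew-symmetric tensor *)

Section SkewSums.
Variables (K : fieldType) (A : vectType K) (r : tensor A A).
Hypothesis r_skew : skew_symmetric r.
Implicit Types (p : A -> A -> A) (f g h : A -> A).

(** Exchanging the two summation indices transposes the array of [r], which changes its sign. *)
Lemma tlift_skew (U : vectType K) (F : A -> A -> U) :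
  tlift F r = - tlift (fun a b => F b a) r.
Proof.
rewrite tliftN /tlift exchange_big; apply: eq_bigr => i _; apply: eq_bigr => j _.
by rewrite -[r in LHS]opprK -r_skew tau_trmx !mxE scaleNr scalerN.
Qed.

Definition rsum (F : A -> A -> A -> A -> tensor3 A) : tensor3 A :=
  tlift (fun a b => tlift (F a b) r) r.

Lemma eq_rsum F G : (forall a b c d, F a b c d = G a b c d) -> rsum F = rsum G.
Proof. by move=> FG; do 2!apply: eq_tlift => ? ?. Qed.

Lemma rsumD F G :
  rsum F + rsum G = rsum (fun a b c d => F a b c d + G a b c d).
Proof. by rewrite /rsum tliftD; apply: eq_tlift => a b; rewrite tliftD. Qed.

Lemma rsumN F : - rsum F = rsum (fun a b c d => - F a b c d).
Proof. by rewrite /rsum tliftN; apply: eq_tlift => a b; rewrite tliftN. Qed.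

Lemma rsumZ k F : k *: rsum F = rsum (fun a b c d => k *: F a b c d).
Proof. by rewrite /rsum tliftZ; apply: eq_tlift => a b; rewrite tliftZ. Qed.

Lemma rsum0 F : (forall a b c d, F a b c d = 0) -> rsum F = 0.
Proof. by move=> F0; do 2!apply: tlift0 => ? ?. Qed.

Lemma rsum_comp (h : tensor3 A -> tensor3 A) F : linear h ->
  h (rsum F) = rsum (fun a b c d => h (F a b c d)).
Proof.
move=> hl; rewrite /rsum tlift_comp //; apply: eq_tlift => a b.
by rewrite tlift_comp.
Qed.

Lemma rsum_swap F : rsum F = rsum (fun a b c d => F c d a b).
Proof. exact: tlift_exchange. Qed.

Lemma rsum_skewl F : rsum F = - rsum (fun a b => F b a).
Proof. exact: tlift_skew. Qed.

Lemma rsum_skewr F : rsum F = - rsum (fun a b c d => F a b d c).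
Proof. by rewrite rsumN; apply: eq_tlift => a b; rewrite tlift_skew tliftN. Qed.

(** [p] takes the letters that meet in one leg; [g] and [h] leave room for an action of x on the
    other two. *)
Definition leg1 p g h := rsum (fun a b c d => p a c \ox (g b \ox h d)).
Definition leg2 p g h := rsum (fun a b c d => g b \ox (p a c \ox h d)).
Definition leg3 p g h := rsum (fun a b c d => g b \ox (h d \ox p a c)).

(** Common shape of the two coproducts: for [Delta_r], [L] is the product and [R] its negative; for
    [delta_r], [L] is the negative of [circ] and [R] the bracket. *)
Definition cob (L R : A -> A -> A) (x : A) : tensor A A :=
  tlift (fun a b => L x a \ox b + a \ox R x b) r.

Lemma tens_assoc_cob (L R : A -> A -> A) (u v : A) :
  tlift (fun x y => x \ox (y \ox v)) (cob L R u)
    = tlift (fun a b => L u a \ox (b \ox v) + a \ox (R u b \ox v)) r.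
Proof.
rewrite /cob tlift_comp; last exact: tlift_linear.
have bl : bilinear_for *:%R *:%R (fun x y : A => x \ox (y \ox v)).
  by split=> [w|w] k s t; rewrite !(tensDl, tensDr, tensZl, tensZr).
by apply: eq_tlift => a b; rewrite (lin_add (tlift_linear _)) !tlift_tens.
Qed.

(** Terms where [L2] acts on [c] need only an exchange of the two copies of [r]; those where [R2]
    acts on [d] also need one flip by skew-symmetry, hence the minus signs. *)
Lemma map_id_cob (L1 R1 L2 R2 : A -> A -> A) (D1 D2 : A -> tensor A A) x :
    D1 =1 cob L1 R1 -> D2 =1 cob L2 R2 -> linear D2 ->
  Defs.map_id D2 (D1 x) = leg1 (fun a c => L2 (L1 x c) a) idfun idfun
    - leg2 (fun a c => R2 (L1 x c) a) idfun idfun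
    + leg1 (fun a c => L2 c a) idfun (R1 x)
    - leg2 (fun a c => R2 c a) idfun (R1 x).
Proof.
move=> D1E D2E D2l.
have ml : linear (Defs.map_id D2).
  by move=> k u v; rewrite /Defs.map_id /= /tmap /tassoc !tlift_linear.
have mt u v : Defs.map_id D2 (u \ox v)
    = tlift (fun a b => L2 u a \ox (b \ox v) + a \ox (R2 u b \ox v)) r.
  by rewrite /Defs.map_id /= tmap_tens // tassoc_tens D2E tens_assoc_cob.
rewrite D1E /cob tlift_comp //.
transitivity
  (rsum (fun a b c d => L2 (L1 x a) c \ox (d \ox b))
   + rsum (fun a b c d => c \ox (R2 (L1 x a) d \ox b))
   + rsum (fun a b c d => L2 a c \ox (d \ox R1 x b))
   + rsum (fun a b c d => c \ox (R2 a d \ox R1 x b))).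
  rewrite !rsumD; apply: eq_tlift => a b.
  by rewrite (lin_add ml) !mt tliftD; apply: eq_tlift => c d; rewrite !addrA.
apply: (f_equal2 +%R); [apply: (f_equal2 +%R); [apply: (f_equal2 +%R)|]|].
- exact: rsum_swap.
- by rewrite rsum_swap rsum_skewl.
- exact: rsum_swap.
- by rewrite rsum_swap rsum_skewl.
Qed.

(** Here the letter [b] meets the second copy, which costs one flip; terms where [R2] acts on [d]
    need a second flip, which restores the sign. *)
Lemma id_map_cob (L1 R1 L2 R2 : A -> A -> A) (D1 D2 : A -> tensor A A) x :
    D1 =1 cob L1 R1 -> D2 =1 cob L2 R2 -> linear D2 ->
  id_map D2 (D1 x) = - leg2 (fun a c => L2 a c) (L1 x) idfun
    + leg3 (fun a c => R2 a c) (L1 x) idfun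
    - leg2 (fun a c => L2 (R1 x a) c) idfun idfun
    + leg3 (fun a c => R2 (R1 x a) c) idfun idfun.
Proof.
move=> D1E D2E D2l.
have ml : linear (id_map D2) by apply: tlift_linear.
have mt u v : id_map D2 (u \ox v)
    = tlift (fun a b => u \ox (L2 v a \ox b) + u \ox (a \ox R2 v b)) r.
  rewrite /id_map tmap_tens // D2E /cob tlift_comp; last exact: tens_linearr.
  by apply: eq_tlift => a b; rewrite tensDr.
rewrite D1E /cob tlift_comp //.
transitivity
  (rsum (fun a b c d => L1 x a \ox (L2 b c \ox d))
   + rsum (fun a b c d => L1 x a \ox (c \ox R2 b d))
   + rsum (fun a b c d => a \ox (L2 (R1 x b) c \ox d))
   + rsum (fun a b c d => a \ox (c \ox R2 (R1 x b) d))).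
  rewrite !rsumD; apply: eq_tlift => a b.
  by rewrite (lin_add ml) !mt tliftD; apply: eq_tlift => c d; rewrite !addrA.
apply: (f_equal2 +%R); [apply: (f_equal2 +%R); [apply: (f_equal2 +%R)|]|].
- exact: rsum_skewl.
- by rewrite rsum_skewl rsum_skewr opprK.
- exact: rsum_skewl.
- by rewrite rsum_skewl rsum_skewr opprK.
Qed.

Lemma tau_id_leg1 p g h : tau_id (leg1 p g h) = leg2 p g h.
Proof.
rewrite rsum_comp; last exact: tlift_linear.
by apply: eq_rsum => a b c d; rewrite tau_id_tens.
Qed.

Lemma tau_id_leg2 p g h : tau_id (leg2 p g h) = leg1 p g h.
Proof.
rewrite rsum_comp; last exact: tlift_linear.
by apply: eq_rsum => a b c d; rewrite tau_id_tens.
Qed.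

(** A permutation that reverses [b] and [d] is compensated by exchanging the two copies of [r]: the
    arguments of [p] are reversed and no sign appears. *)
Lemma tau_id_leg3 p g h : tau_id (leg3 p g h) = leg3 (fun a c => p c a) h g.
Proof.
rewrite rsum_comp; last exact: tlift_linear.
by rewrite rsum_swap; apply: eq_rsum => a b c d; rewrite tau_id_tens.
Qed.

Lemma id_tau_leg1 p g h : id_tau (leg1 p g h) = leg1 (fun a c => p c a) h g.
Proof.
rewrite rsum_comp; last exact: tlift_linear.
by rewrite rsum_swap; apply: eq_rsum => a b c d; rewrite id_tau_tens.
Qed.

Lemma id_tau_leg2 p g h : id_tau (leg2 p g h) = leg3 p g h.
Proof.
rewrite rsum_comp; last exact: tlift_linear.
by apply: eq_rsum => a b c d; rewrite id_tau_tens.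
Qed.

Lemma id_tau_leg3 p g h : id_tau (leg3 p g h) = leg2 p g h.
Proof.
rewrite rsum_comp; last exact: tlift_linear.
by apply: eq_rsum => a b c d; rewrite id_tau_tens.
Qed.

Lemma xi_leg1 p g h : xi (leg1 p g h) = leg3 p g h.
Proof.
rewrite rsum_comp; last exact: tlift_linear.
by apply: eq_rsum => a b c d; rewrite xi_tens.
Qed.

Lemma xi_leg2 p g h : xi (leg2 p g h) = leg1 (fun a c => p c a) h g.
Proof.
rewrite rsum_comp; last exact: tlift_linear.
by rewrite rsum_swap; apply: eq_rsum => a b c d; rewrite xi_tens.
Qed.

Lemma xi_leg3 p g h : xi (leg3 p g h) = leg2 (fun a c => p c a) h g.
Proof.
rewrite rsum_comp; last exact: tlift_linear.
by rewrite rsum_swap; apply: eq_rsum => a b c d; rewrite xi_tens.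
Qed.

Lemma tmap3_tens f g h (x y z : A) : linear f -> linear g -> linear h ->
  tmap f (tmap g h) (x \ox (y \ox z)) = f x \ox (g y \ox h z).
Proof. by move=> fl gl hl; rewrite !tmap_tens //; apply: tlift_linear. Qed.

(** The middle term of A(r) needs one flip, which absorbs its minus sign; the last term needs two.
    In use, one of [f], [g], [h] is an action of x and the others are identities. *)
Lemma ybe_A_leg (mul : A -> A -> A) f g h :
    linear f -> linear g -> linear h -> ybe_A mul r = 0 ->
  leg1 (fun a c => f (mul a c)) g h + leg2 (fun a c => g (mul c a)) f h
    + leg3 (fun a c => h (mul a c)) f g = 0.
Proof.
move=> fl gl hl A0; have tl := tmap_linear f (tmap g h).
have {A0}: tmap f (tmap g h) (ybe_A mul r) = 0 by rewrite A0 (lin_zero tl).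
rewrite rsum_comp // => <-.
transitivity
  (leg1 (fun a c => f (mul a c)) g h
   + rsum (fun a b c d => - (f c \ox (g (mul a d) \ox h b)))
   + rsum (fun a b c d => f a \ox (g c \ox h (mul b d)))).
  rewrite -rsumN [in RHS]rsum_swap [in RHS]rsum_skewl opprK.
  by rewrite [X in _ = _ + X]rsum_skewl [X in _ = _ + - X]rsum_skewr opprK.
rewrite !rsumD; apply: eq_rsum => a b c d.
by rewrite /ybe_A_term !(lin_add tl) (lin_opp tl) !tmap3_tens.
Qed.

Lemma ybe_T_leg (circ : A -> A -> A) f g h :
    linear f -> linear g -> linear h -> ybe_T circ r = 0 ->
  leg1 (fun a c => f (circ a c)) g h - leg2 (fun a c => g (circ a c)) f h
    - leg3 (fun a c => h (bracket circ a c)) f g = 0.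
Proof.
move=> fl gl hl A0; have tl := tmap_linear f (tmap g h).
have {A0}: tmap f (tmap g h) (ybe_T circ r) = 0 by rewrite A0 (lin_zero tl).
rewrite rsum_comp // => <-.
transitivity
  (leg1 (fun a c => f (circ a c)) g h
   + rsum (fun a b c d => f a \ox (g (circ b c) \ox h d))
   + rsum (fun a b c d => - (f a \ox (g c \ox h (bracket circ b d))))).
  congr (_ + _ + _); first exact/esym/rsum_skewl.
  by rewrite -rsumN [in RHS]rsum_skewl [in RHS]rsum_skewr opprK.
rewrite !rsumD; apply: eq_rsum => a b c d.
by rewrite /ybe_T_term !(lin_add tl) (lin_opp tl) !tmap3_tens.
Qed.

(** The last two legs enter T(r) asymmetrically; exchanging them gives a second form of the
    equation, for use where [xi] or [id_tau] has permuted the legs. *)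
Lemma ybe_T_leg' (circ : A -> A -> A) f g h :
    linear f -> linear g -> linear h -> ybe_T circ r = 0 ->
  leg1 (fun a c => f (circ c a)) g h - leg3 (fun a c => h (circ a c)) f g
    - leg2 (fun a c => g (bracket circ a c)) f h = 0.
Proof.
move=> fl gl hl T0; have /(congr1 (@id_tau K A)) := ybe_T_leg fl hl gl T0.
have tl : linear (@id_tau K A) by apply: tlift_linear.
rewrite (lin_zero tl) !(lin_add tl, lin_opp tl).
by rewrite id_tau_leg1 id_tau_leg2 id_tau_leg3.
Qed.

End SkewSums.

(** * Vanishing proved by subtracting known identities *)

Lemma additive_eq (K : fieldType) (V : vectType K) (u v : V) :
  (forall phi : {additive V -> K}, phi u = phi v) -> u = v.
Proof.
(* Coordinates are additive and separate vectors; taking values in [K] makes [ring] applicable. *)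
move=> uv; apply: coord_eq => i.
exact: (uv (coord (vbasis {:V}) i : {additive V -> K^o})).
Qed.

(** For backward use: each application takes [k] copies of a known identity off the goal, until a
    formal identity remains. The next two lemmas do the same with vanishing tensors, a coefficient 2
    being a repeated application. *)
Lemma eq0_lincomb (V : zmodType) (k : int) (l r X : V) :
  l = r -> X - (l - r) *~ k = 0 -> X = 0.
Proof. by move=> ->; rewrite subrr mul0rz subr0. Qed.

Lemma eq0_sub (V : zmodType) (X Y : V) : Y = 0 -> X - Y = 0 -> X = 0.
Proof. by move=> ->; rewrite subr0. Qed.

Lemma eq0_add (V : zmodType) (X Y : V) : Y = 0 -> X + Y = 0 -> X = 0.
Proof. by move=> ->; rewrite addr0. Qed.

(* [ring] pushes an additive map on [V] down to the atoms. *)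
Ltac module := apply: additive_eq => phi; ring.

(** * The coproducts of [r] on an anti-pre-Lie Poisson algebra *)

Section Coboundary.
Variables (K : fieldType) (A : vectType K) (mul circ : A -> A -> A).
Hypothesis K2 : (2 : K) != 0.
Hypothesis A_aplp : aplp_algebra mul circ.
Variable r : tensor A A.
Hypothesis r_skew : skew_symmetric r.
Implicit Types x y z a b c d : A.

Let mulC : commutative mul := mul_comm (aplp_mul A_aplp).
Let mulA : associative mul := mul_assoc (aplp_mul A_aplp).
Let mul_bil := mul_bilinear (aplp_mul A_aplp).
Let circ_bil := circ_bilinear (aplp_circ A_aplp).

Let mul_linl y : linear (mul^~ y). Proof. exact: mul_bil.1. Qed.
Let mul_linr x : linear (mul x). Proof. exact: mul_bil.2. Qed.
Let circ_linl y : linear (circ^~ y). Proof. exact: circ_bil.1. Qed.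
Let circ_linr x : linear (circ x). Proof. exact: circ_bil.2. Qed.

Let mulE :=
  (fun z => let l := mul_linl z in (lin_add l, lin_opp l, lin_scale l),
   fun z => let l := mul_linr z in (lin_add l, lin_opp l, lin_scale l)).
Let circE :=
  (fun z => let l := circ_linl z in (lin_add l, lin_opp l, lin_scale l),
   fun z => let l := circ_linr z in (lin_add l, lin_opp l, lin_scale l)).

Let bracket_lin x : linear (bracket circ x).
Proof. by move=> k u v; rewrite /bracket !circE scalerBr opprD addrACA. Qed.

Lemma mul_circ x y z :
  mul z (circ x y) = 2 *: circ x (mul y z) - circ (mul z x) y.
Proof. by rewrite (aplp_compat2 A_aplp) addrC addKr. Qed.

(** Once [mul_circ] has removed the mixed words from the first compatibility, the words (x . y) o z
    and (y . x) o z cancel and twice this identity is left, hence the division by 2. *)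
Lemma circ_mul_sym x y z :
  circ x (mul y z) + circ (mul y z) x = circ y (mul x z) + circ (mul x z) y.
Proof.
apply: (scalerI K2); have := aplp_compat1 A_aplp x y z.
rewrite ![mul (circ _ _) z]mulC !mul_circ.
rewrite (mulC z x) (mulC z y) (mulC y x) !scaler_nat => H.
by apply/subr0_eq/(eq0_lincomb (k := 1) H); module.
Qed.

Let Delta_cob x : Delta_r mul r x = cob r mul (fun x y => - mul x y) x.
Proof.
rewrite /Delta_r /tmap tliftN tliftD; apply: eq_tlift => a b.
by rewrite tensNr.
Qed.

Let delta_cob x :
  delta_r circ r x = cob r (fun x y => - circ x y) (bracket circ) x.
Proof.
rewrite /delta_r /tmap tliftN tliftD; apply: eq_tlift => a b.
by rewrite tensNl.
Qed.

Lemma tmap_cob (f g : A -> A) (L R : A -> A -> A) x : linear f -> linear g ->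
  tmap f g (cob r L R x)
    = tlift (fun a b => f (L x a) \ox g b + f a \ox g (R x b)) r.
Proof.
move=> fl gl; rewrite /cob tlift_comp; last exact: tlift_linear.
by apply: eq_tlift => a b; rewrite (lin_add (tmap_linear _ _)) !tmap_tens.
Qed.

Let tau_linear : linear (@tau K A). Proof. exact: tlift_linear. Qed.
Let tauE :=
  (lin_add tau_linear, lin_opp tau_linear, lin_scale tau_linear, @tau_tens K A).

(** Renaming by skew-symmetry returns each letter to the leg from which [tau] moved it, so a tensor
    and its swap can be compared summand by summand. *)
Lemma tau_tlift (F : A -> A -> tensor A A) :
  tau (tlift F r) = tlift (fun a b => - tau (F b a)) r.
Proof. by rewrite tlift_comp // tlift_skew // tliftN. Qed.

Let lin_id : linear (@idfun A). Proof. by []. Qed.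

Let anti := circ_anti (aplp_circ A_aplp).
Let cyc := circ_cyclic (aplp_circ A_aplp).

Lemma Delta_r_linear : linear (Delta_r mul r).
Proof.
move=> k x y; rewrite !Delta_cob /cob tliftZ tliftD; apply: eq_tlift => a b.
rewrite !mulE !(tensDl, tensDr, tensZl, tensZr, tensNl, tensNr).
by rewrite scalerDr !scalerN opprD addrACA.
Qed.

Lemma delta_r_linear : linear (delta_r circ r).
Proof.
move=> k x y; rewrite !delta_cob /cob tliftZ tliftD; apply: eq_tlift => a b.
rewrite /bracket !circE !(tensDl, tensDr, tensZl, tensZr, tensNl, tensNr).
by rewrite !(scalerDr, scalerN) ?opprD; module.
Qed.

(** The first digit names the leg in which an identity of [A] is placed; a second digit 3 marks the
    third tensor power. *)
Let at1 b (u v : A) : u = v -> u \ox b = v \ox b. Proof. by move->. Qed.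
Let at2 a (u v : A) : u = v -> a \ox u = a \ox v. Proof. by move->. Qed.
Let at13 b d (u v : A) : u = v -> u \ox (b \ox d) = v \ox (b \ox d).
Proof. by move->. Qed.
Let at23 b d (u v : A) : u = v -> b \ox (u \ox d) = b \ox (v \ox d).
Proof. by move->. Qed.
Let at33 b d (u v : A) : u = v -> b \ox (d \ox u) = b \ox (d \ox v).
Proof. by move->. Qed.

Let tau_idE := (lin_add (tlift_linear _ : linear (@tau_id K A)),
  lin_opp (tlift_linear _ : linear (@tau_id K A)),
  tau_id_leg1 r, tau_id_leg2 r, tau_id_leg3 r).
Let id_tauE := (lin_add (tlift_linear _ : linear (@id_tau K A)),
  lin_opp (tlift_linear _ : linear (@id_tau K A)),
  id_tau_leg1 r, id_tau_leg2 r, id_tau_leg3 r).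
Let xiE := (lin_add (tlift_linear _ : linear (@xi K A)),
  lin_opp (tlift_linear _ : linear (@xi K A)),
  xi_leg1 r, xi_leg2 r, xi_leg3 r).

Let coE x :=
  (map_id_cob r_skew x Delta_cob Delta_cob Delta_r_linear,
   map_id_cob r_skew x Delta_cob delta_cob delta_r_linear,
   map_id_cob r_skew x delta_cob Delta_cob Delta_r_linear,
   map_id_cob r_skew x delta_cob delta_cob delta_r_linear,
   id_map_cob r_skew x Delta_cob Delta_cob Delta_r_linear,
   id_map_cob r_skew x Delta_cob delta_cob delta_r_linear,
   id_map_cob r_skew x delta_cob Delta_cob Delta_r_linear,
   id_map_cob r_skew x delta_cob delta_cob delta_r_linear).

Ltac to_tlift :=
  rewrite ?(Delta_cob, delta_cob) ?tmap_cob //;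
  rewrite ?(tau_tlift, tliftN, tliftZ, tliftD);
  apply: tlift0 => a b /=.
(** [ring] sees tensors of products as atoms, so commuting factors are first put in a fixed
    order. *)
Ltac mul_sort a b x := rewrite ?(mulC b a) ?(mulC x a) ?(mulC x b).
Ltac mul_normal :=
  rewrite /bracket ?(mulE, circE) ?[mul (circ _ _) _]mulC ?mul_circ.
Ltac tensor_ring :=
  rewrite /bracket ?(mulE, circE);
  rewrite ?(tensDl, tensDr, tensZl, tensZr, tensNl, tensNr, tauE);
  rewrite ?(tens0l, tens0r) ?scaler_nat; module.
Ltac to_rsum :=
  rewrite /leg1 /leg2 /leg3 ?(rsumN, rsumZ, rsumD); apply: rsum0 => a b c d /=.
Ltac sub0 := apply/eqP; rewrite -subr_eq0; apply/eqP.

(** * Coalgebra axioms of each coproduct *)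

Lemma Delta_coassoc_ybe : ybe_A mul r = 0 -> forall x,
  id_map (Delta_r mul r) (Delta_r mul r x)
    = Defs.map_id (Delta_r mul r) (Delta_r mul r x).
Proof.
move=> A0 x; rewrite !coE; sub0.
(* The triple products in the second leg cancel; the difference of the two sides is x acting on the
   third leg of A(r) minus x acting on the first. *)
apply: (eq0_sub (ybe_A_leg r_skew lin_id lin_id (mul_linr x) A0)).
apply: (eq0_add (ybe_A_leg r_skew (mul_linr x) lin_id lin_id A0)).
to_rsum.
(* Every triple product is brought to the form [mul (mul x a) c]. *)
rewrite ?(mulC c a) ?mulA -[mul (mul x c) a]mulA (mulC c a) ?mulA.
tensor_ring.
Qed.

Lemma delta_anti_ybe : ybe_T circ r = 0 -> forall x,
  id_map (delta_r circ r) (delta_r circ r x)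
    - tau_id (id_map (delta_r circ r) (delta_r circ r x))
  = tau_id (Defs.map_id (delta_r circ r) (delta_r circ r x))
    - Defs.map_id (delta_r circ r) (delta_r circ r x).
Proof.
move=> T0 x; rewrite !coE !tau_idE; sub0.
(* Up to degree three identities the difference is [circ x] on the first leg of T(r), plus [circ x]
   on the second, minus [bracket circ x] on the third; the last two lines make up this bracket. *)
apply: (eq0_sub (ybe_T_leg r_skew (circ_linr x) lin_id lin_id T0)).
apply: (eq0_sub (ybe_T_leg r_skew lin_id (circ_linr x) lin_id T0)).
apply: (eq0_add (ybe_T_leg r_skew lin_id lin_id (circ_linr x) T0)).
apply: (eq0_sub (ybe_T_leg r_skew lin_id lin_id (circ_linl x) T0)).
to_rsum.
apply: (eq0_lincomb (k := -1) (at13 b d (anti x a c))).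
apply: (eq0_lincomb (k := 1) (at23 b d (anti x a c))).
apply: (eq0_lincomb (k := -1) (at33 b d (anti x a c))).
apply: (eq0_lincomb (k := 1) (at33 b d (anti x c a))).
apply: (eq0_lincomb (k := -1) (at33 b d (anti a c x))).
apply: (eq0_lincomb (k := 2) (at33 b d (cyc x a c))).
tensor_ring.
Qed.

Lemma delta_cyclic_ybe : ybe_T circ r = 0 -> forall x,
  let t := tau_id (Defs.map_id (delta_r circ r) (delta_r circ r x))
    - Defs.map_id (delta_r circ r) (delta_r circ r x) in
  t + xi t + xi (xi t) = 0.
Proof.
move=> T0 x /=; rewrite !coE !tau_idE !xiE.
(* Let T' be T(r) with its last two legs exchanged. Up to degree three identities the cyclic sum is
   ad(x) on the first leg of T' - T(r), minus ad(x) on the second leg of T', plus ad(x) on the third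
   leg of T(r). *)
apply: (eq0_sub (ybe_T_leg' r_skew (circ_linr x) lin_id lin_id T0)).
apply: (eq0_add (ybe_T_leg r_skew (circ_linr x) lin_id lin_id T0)).
apply: (eq0_add (ybe_T_leg' r_skew (circ_linl x) lin_id lin_id T0)).
apply: (eq0_sub (ybe_T_leg r_skew (circ_linl x) lin_id lin_id T0)).
apply: (eq0_add (ybe_T_leg' r_skew lin_id (circ_linr x) lin_id T0)).
apply: (eq0_sub (ybe_T_leg' r_skew lin_id (circ_linl x) lin_id T0)).
apply: (eq0_sub (ybe_T_leg r_skew lin_id lin_id (circ_linr x) T0)).
apply: (eq0_add (ybe_T_leg r_skew lin_id lin_id (circ_linl x) T0)).
to_rsum.
apply: (eq0_lincomb (k := 1) (at13 b d (anti x a c))).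
apply: (eq0_lincomb (k := -1) (at13 b d (anti x c a))).
apply: (eq0_lincomb (k := -1) (at13 b d (cyc x a c))).
apply: (eq0_lincomb (k := -1) (at23 b d (anti x a c))).
apply: (eq0_lincomb (k := 1) (at23 b d (anti x c a))).
apply: (eq0_lincomb (k := 1) (at23 b d (cyc x a c))).
apply: (eq0_lincomb (k := 1) (at33 b d (anti x a c))).
apply: (eq0_lincomb (k := -1) (at33 b d (anti x c a))).
apply: (eq0_lincomb (k := -1) (at33 b d (cyc x a c))).
tensor_ring.
Qed.

(** * Identities linear in [r]: cocommutativity and the bialgebra compatibilities *)

Lemma Delta_r_cocomm x : tau (Delta_r mul r x) = Delta_r mul r x.
Proof. by sub0; to_tlift; tensor_ring. Qed.

Lemma Delta_mul x y :
  Delta_r mul r (mul x y)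
    = tmap (mul x) idfun (Delta_r mul r y)
      + tmap idfun (mul y) (Delta_r mul r x).
Proof.
sub0; to_tlift; rewrite ?(mulA, mulE) ?(mulC y x); tensor_ring.
Qed.

Lemma delta_circ x y :
  let t := delta_r circ r (circ x y) - tmap (circ x) idfun (delta_r circ r y)
           - tmap idfun (circ x) (delta_r circ r y)
           + tmap idfun (circ^~ y) (delta_r circ r x) in
  t - tau t = 0.
Proof.
rewrite /=; to_tlift.
(* Antisymmetrisation makes the two legs mirror images, so the same identity serves once with [b]
   and once with [a]. *)
apply: (eq0_lincomb (k := 1) (at2 a (anti x b y))).
apply: (eq0_lincomb (k := 1) (at1 b (anti x a y))).
tensor_ring.
Qed.

(** Terms with x and y in different legs cancel. The first leg leaves [circ_anti], the second the
    Jacobi identity of the bracket, which follows from [circ_anti] and [circ_cyclic]. *)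
Lemma delta_bracket x y :
  delta_r circ r (bracket circ x y)
      = (tmap idfun (bracket circ x) (delta_r circ r y)
           - tmap (circ x) idfun (delta_r circ r y))
        - (tmap idfun (bracket circ y) (delta_r circ r x)
             - tmap (circ y) idfun (delta_r circ r x)).
Proof.
sub0; to_tlift.
apply: (eq0_lincomb (k := -1) (at2 a (anti x y b))).
apply: (eq0_lincomb (k := 2) (at2 a (cyc x y b))).
apply: (eq0_lincomb (k := 1) (at2 a (anti x b y))).
apply: (eq0_lincomb (k := -1) (at2 a (anti y b x))).
apply: (eq0_lincomb (k := -1) (at1 b (anti x y a))).
tensor_ring.
Qed.

(** The first leg is the second compatibility itself; the second leg adds up to -3 times one
    instance of [circ_mul_sym]. *)
Lemma coboundary_B1 x y :
  2 *: tmap (circ x) idfun (Delta_r mul r y)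
    - 2 *: tmap idfun (mul y) (delta_r circ r x)
    + delta_r circ r (mul x y) + tmap (mul y) idfun (delta_r circ r x)
    - tmap idfun (bracket circ x) (Delta_r mul r y) = 0.
Proof.
to_tlift; mul_normal.
apply: (eq0_lincomb (k := -3) (at2 a (circ_mul_sym x b y))).
mul_sort a x y; mul_sort b x y.
tensor_ring.
Qed.

(** The first leg is the first compatibility, that is, twice [circ_mul_sym]; the second leg is -3
    times another instance. *)
Lemma coboundary_B2 x y :
  2 *: Delta_r mul r (bracket circ x y)
    + tmap idfun (bracket circ y) (Delta_r mul r x)
    - tmap (mul x) idfun (delta_r circ r y)
    - tmap idfun (bracket circ x) (Delta_r mul r y)
    + tmap (mul y) idfun (delta_r circ r x) = 0.
Proof.
to_tlift; mul_normal.
apply: (eq0_lincomb (k := -3) (at2 a (circ_mul_sym x y b))).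
apply: (eq0_lincomb (k := 2) (at1 b (circ_mul_sym x y a))).
mul_sort a x y; mul_sort b x y.
tensor_ring.
Qed.

Lemma coboundary_B3 x y :
  2 *: tmap idfun (mul y) (delta_r circ r x)
    - 2 *: tmap (circ x) idfun (Delta_r mul r y)
    + Delta_r mul r (circ x y) + tmap (circ^~ y) idfun (Delta_r mul r x)
    + tau (tmap (mul x) idfun (delta_r circ r y))
    - tmap idfun (mul x) (delta_r circ r y) = 0.
Proof.
to_tlift; mul_normal.
apply: (eq0_lincomb (k := 2) (at2 a (circ_mul_sym x b y))).
mul_sort a x y; mul_sort b x y.
tensor_ring.
Qed.

(** The swap brings the words of both legs together, and their sum in each leg is the second
    compatibility. *)
Lemma coboundary_B4 x y :
  let t := 2 *: delta_r circ r (mul x y) - tmap (mul x) idfun (delta_r circ r y)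
           - tmap idfun (mul x) (delta_r circ r y)
           - tmap idfun (circ^~ y) (Delta_r mul r x) in
  tau t - t = 0.
Proof.
rewrite /=; to_tlift; mul_normal; mul_sort a x y; mul_sort b x y.
tensor_ring.
Qed.

(** * Coalgebra axioms relating the two coproducts *)

Lemma cocompat1_ybe : ybe_T circ r = 0 -> forall x,
  2 *: Defs.map_id (delta_r circ r) (Delta_r mul r x)
    - 2 *: tau_id (Defs.map_id (delta_r circ r) (Delta_r mul r x))
  = tau_id (id_map (delta_r circ r) (Delta_r mul r x))
    - id_map (delta_r circ r) (Delta_r mul r x).
Proof.
move=> T0 x; rewrite !coE !tau_idE; sub0.
(* The difference is twice [mul x] on the third leg of T(r), minus [mul x] on the first and on the
   second, up to identities in the third leg. *)
apply: (eq0_add (ybe_T_leg r_skew (mul_linr x) lin_id lin_id T0)).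
apply: (eq0_add (ybe_T_leg r_skew lin_id (mul_linr x) lin_id T0)).
apply: (eq0_sub (ybe_T_leg r_skew lin_id lin_id (mul_linr x) T0)).
apply: (eq0_sub (ybe_T_leg r_skew lin_id lin_id (mul_linr x) T0)).
to_rsum; mul_normal.
apply: (eq0_lincomb (k := -3) (at33 b d (circ_mul_sym x a c))).
apply: (eq0_lincomb (k := 3) (at33 b d (circ_mul_sym x c a))).
mul_sort a c x.
tensor_ring.
Qed.

Lemma cocompat2_ybe : ybe_A mul r = 0 -> ybe_T circ r = 0 -> forall x,
  2 *: id_map (Delta_r mul r) (delta_r circ r x)
    = id_tau (Defs.map_id (Delta_r mul r) (delta_r circ r x))
      + Defs.map_id (delta_r circ r) (Delta_r mul r x).
Proof.
move=> A0 T0 x; rewrite !coE !id_tauE; sub0.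
(* Both equations enter: twice [circ x] on the first leg of A(r), minus [bracket circ x] on its
   second leg, minus [mul x] on the third leg of T(r) with its last two legs exchanged. *)
apply: (eq0_sub (ybe_A_leg r_skew (circ_linr x) lin_id lin_id A0)).
apply: (eq0_sub (ybe_A_leg r_skew (circ_linr x) lin_id lin_id A0)).
apply: (eq0_add (ybe_A_leg r_skew lin_id (circ_linr x) lin_id A0)).
apply: (eq0_sub (ybe_A_leg r_skew lin_id (circ_linl x) lin_id A0)).
apply: (eq0_add (ybe_T_leg' r_skew lin_id lin_id (mul_linr x) T0)).
to_rsum; mul_normal.
apply: (eq0_lincomb (k := -3) (at23 b d (circ_mul_sym x a c))).
apply: (eq0_lincomb (k := -2) (at33 b d (circ_mul_sym x a c))).
mul_sort a c x.
tensor_ring.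
Qed.

(** * Assembly of the bialgebra *)

Lemma coboundary_aplp_bialgebra : aplp_ybe_solution mul circ r ->
  aplp_bialgebra mul circ (Delta_r mul r) (delta_r circ r).
Proof.
case=> A0 T0; have [mulP circP _ _] := A_aplp.
have coD : cocomm_coassoc_coalgebra (Delta_r mul r).
  split; [exact: Delta_r_linear | exact: Delta_r_cocomm |].
  exact: Delta_coassoc_ybe.
have cod : anti_pre_lie_coalgebra (delta_r circ r).
  split; [exact: delta_r_linear | exact: delta_anti_ybe |].
  exact: delta_cyclic_ybe.
split.
- exact: A_aplp.
- split; [exact: coD | exact: cod | exact: cocompat1_ybe | exact: cocompat2_ybe].
- split; [exact: mulP | exact: coD | exact: Delta_mul].
- split; [exact: circP | exact: cod | exact: delta_circ | exact: delta_bracket].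
- exact: coboundary_B1.
- exact: coboundary_B2.
- exact: coboundary_B3.
- exact: coboundary_B4.
Qed.

End Coboundary.

Theorem corollary3p38 (K : closedFieldType) (K_char0 : [pchar K] =i pred0)
    (A : vectType K) (mul circ : A -> A -> A)
    (A_aplp : aplp_algebra mul circ)
    (r : tensor A A) (r_skew : skew_symmetric r)
    (r_sol : aplp_ybe_solution mul circ r) :
  aplp_bialgebra mul circ (Delta_r mul r) (delta_r circ r).
Proof.
have K2 : (2 : K) != 0 by rewrite (proj1 (pcharf0P K) K_char0).
exact: coboundary_aplp_bialgebra.
Qed.
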